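(* Let $(X,\tau)$ be a semi-symmetric space in which the intersection of an arbitrary family of closed sets is semi-closed. Then the following statements are equivalent: (1) $(X,\tau)$ is semi-$T_0$; (2) $(X,\tau)$ is semi-$T_1$; (3) $(X,\tau)$ is semi-$T_\omega$; (4) $(X,\tau)$ is semi-$T_{\frac{5\omega}{8}}$; (5) $(X,\tau)$ is semi-$T_{\frac{3\omega}{8}}$; (6) $(X,\tau)$ is semi-$T_{\frac{\omega}{4}}$.
   Context: Inclusions $\subset$ are not necessarily strict. A space (Alexandroff $\sigma$-space) $(X,\tau)$ is a nonempty set $X$ with a family $\mathcal{F}$ of subsets, called closed sets, that contains $\emptyset$ and $X$ and is closed under countable intersections and finite unions; $\tau$ is the family of complements of closed sets, called open sets. The closure $\overline{A}$ of $A\subset X$ is the intersection of all closed sets containing $A$ (it need not be closed). A set $A$ is semi-open if there is an open set $G$ with $G\subset A\subset\overline{G}$; it is semi-closed if $X-A$ is semi-open. The semi-closure $\overline{A}_s$ is the intersection of all semi-closed sets containing $A$ (it need not be semi-closed). $A$ is $sg^*$-closed if there is a semi-closed set $F\supset A$ such that $F\subset O$ for every semi-open set $O\supset A$. $(X,\tau)$ is: semi-symmetric if for all $x,y\in X$, $x\in\overline{\{y\}}_s$ implies $y\in\overline{\{x\}}_s$; semi-$T_0$ if for any two distinct points there is a semi-open set containing one of them but not the other; semi-$T_1$ if for any distinct $x,y$ there are semi-open sets $U,V$ with $x\in U$, $y\notin U$, $y\in V$, $x\notin V$; semi-$T_\omega$ if every $sg^*$-closed set is semi-closed; semi-$T_{\frac{\omega}{4}}$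 (respectively semi-$T_{\frac{3\omega}{8}}$, semi-$T_{\frac{5\omega}{8}}$) if for every finite (respectively countable, arbitrary) subset $P$ of $X$ and every $y\in X-P$ there is a set $A_y\supset P$ with $y\notin A_y$ such that $A_y$ is either semi-open or semi-closed. *)

(* Defs.v *)
From mathcomp Require Import all_boot.
From mathcomp Require Import boolp classical_sets functions cardinality.

Set Implicit Arguments.
Unset Strict Implicit.
Unset Printing Implicit Defensive.

Local Open Scope classical_set_scope.

(* Alexandroff sigma-spaces are not topological spaces in general: arbitrary
   intersections of closed sets need not be closed. *)
Record sigmaSpace := SigmaSpace {
  point :> Type;
  point_nonempty : [set: point] !=set0;
  is_closed : set (set point);
  is_closed0 : is_closed set0;
  is_closedT : is_closed setT;
  is_closed_bigcap : forall G : set (set point),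
    countable G -> G `<=` is_closed -> is_closed (\bigcap_(A in G) A);
  is_closed_bigcup : forall G : set (set point),
    finite_set G -> G `<=` is_closed -> is_closed (\bigcup_(A in G) A)
}.

Section SigmaSpaceNotions.
Variable X : sigmaSpace.
Implicit Types A F G O P U V : set X.

Definition is_open G := is_closed (~` G).

(* Not closed in general; likewise semi_closure below need not be
   semi-closed. *)
Definition sigma_closure A : set X :=
  \bigcap_(F in [set F | is_closed F /\ A `<=` F]) F.

Definition semi_open A :=
  exists G, [/\ is_open G, G `<=` A & A `<=` sigma_closure G].

Definition semi_closed A := semi_open (~` A).

Definition semi_closure A : set X :=
  \bigcap_(F in [set F | semi_closed F /\ A `<=` F]) F.

Definition sg_star_closed A :=
  exists F, [/\ semi_closed F, A `<=` F &
    forall O, semi_open O -> A `<=` O -> F `<=` O].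

Definition semi_symmetric :=
  forall x y : X, semi_closure [set y] x -> semi_closure [set x] y.

Definition semi_T0 :=
  forall x y : X, x <> y ->
    exists U, semi_open U /\ ((U x /\ ~ U y) \/ (U y /\ ~ U x)).

Definition semi_T1 :=
  forall x y : X, x <> y ->
    exists U V, [/\ semi_open U, semi_open V, U x /\ ~ U y & V y /\ ~ V x].

Definition semi_Tomega := forall A, sg_star_closed A -> semi_closed A.

Definition separates_points_from P :=
  forall y : X, ~ P y ->
    exists A, [/\ P `<=` A, ~ A y & semi_open A \/ semi_closed A].

Definition semi_Tomega_4 := forall P, finite_set P -> separates_points_from P.

Definition semi_T3omega_8 := forall P, countable P -> separates_points_from P.

Definition semi_T5omega_8 := forall P, separates_points_from P.

End SigmaSpaceNotions.

Arguments semi_symmetric : clear implicits.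
Arguments semi_T0 : clear implicits.
Arguments semi_T1 : clear implicits.
Arguments semi_Tomega : clear implicits.
Arguments semi_Tomega_4 : clear implicits.
Arguments semi_T3omega_8 : clear implicits.
Arguments semi_T5omega_8 : clear implicits.

(* Main.v *)
(** The hypothesis on intersections makes arbitrary unions of semi-open sets
    semi-open: if [G i `<=` A i `<=` cl (G i)], then [\bigcup_i G i] has a
    semi-closed complement, so it lies between an open set [G] and [cl G],
    and then [\bigcup_i A i] does too. So in a semi-[T1] space points are
    semi-closed, and a point [y] of [F `\` A] would contradict the choice of
    [F], via the semi-open set [~` [set y]]. Conversely, for any [y] either
    [~` [set y]] is semi-open, or its only semi-open superset is the whole
    space, which makes it sg*-closed, hence semi-closed by semi-[Tomega]: it
    separates [y] from every set that misses [y]. *)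
Require Import Defs.
From mathcomp Require Import all_boot.
From mathcomp Require Import boolp classical_sets functions cardinality.

Local Open Scope classical_set_scope.

Section SigmaSpaceTheory.
Variable X : sigmaSpace.
Implicit Types A B F O : set X.

Lemma semi_closedC A : semi_closed (~` A) <-> semi_open A.
Proof. by rewrite /semi_closed setCK. Qed.

(** Closure is idempotent even where it is not closed: a closed set containing [B] contains
    [sigma_closure B], hence [A]. *)
Lemma sigma_closure_sub A B :
  A `<=` sigma_closure B -> sigma_closure A `<=` sigma_closure B.
Proof.
by move=> AB x clAx F [cF BF]; apply: clAx; split=> // z /AB; apply.
Qed.

Lemma semi_closedT : semi_closed [set: X].
Proof.
exists set0; rewrite setCT; split=> //.
by rewrite /is_open setC0; exact: is_closedT.
Qed.

Lemma semi_open_bigcup :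
  (forall C : set (set X),
     C `<=` @is_closed X -> semi_closed (\bigcap_(F in C) F)) ->
  forall S : set (set X), S `<=` @semi_open X -> semi_open (\bigcup_(A in S) A).
Proof.
move=> capX S oS.
(* Collecting every witness [G] of every [A] in [S] avoids choosing one for each [A]. *)
pose W := [set G | is_open G /\
                   exists2 A, S A & G `<=` A /\ A `<=` sigma_closure G].
have [G [oG GW WG]] : semi_open (\bigcup_(G in W) G).
  apply/semi_closedC; rewrite setC_bigcup -(bigcap_image W setC id).
  by apply: capX => _ [G [oG _] <-].
exists G; split=> //.
  by move=> x /GW [H [_ [A SA [HA _]]] Hx]; exists A => //; exact: HA.
move=> x [A SA Ax]; have [H [oH HA AH]] := oS _ SA.
apply: (sigma_closure_sub H); last exact: AH.
by apply: subset_trans WG => z Hz; exists H => //; split=> //; exists A.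
Qed.

Lemma semi_T0_T1 : semi_symmetric X -> semi_T0 X -> semi_T1 X.
Proof.
move=> symX T0.
suff sep (x y : X) U : semi_open U -> U x -> ~ U y ->
    exists V, [/\ semi_open V, V y & ~ V x].
  move=> x y /T0 [U [oU [] [Ua Ub]]]; have [V [oV Vb Va]] := sep _ _ _ oU Ua Ub.
    by exists U, V.
  by exists V, U.
move=> oU Ux Uy.
have /existsNP [F /not_implyP [[cF Fx] Fy]] : ~ semi_closure [set x] y.
  move/symX/(_ (~` U)); apply=> //.
  by split=> [|_ ->]; first exact/semi_closedC.
by exists (~` F); split=> //; apply; exact: Fx.
Qed.

Lemma semi_T1_semi_open_setC1 :
  (forall S : set (set X),
     S `<=` @semi_open X -> semi_open (\bigcup_(A in S) A)) ->
  semi_T1 X -> forall y : X, semi_open (~` [set y]).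
Proof.
move=> bigcupX T1 y.
suff -> : ~` [set y] = \bigcup_(U in [set U | semi_open U /\ ~ U y]) U.
  by apply: bigcupX => U [].
apply/seteqP; split=> [x /T1 [U [_ [oU _ [Ux Uy] _]]]|x [U [_ Uy] Ux] xy].
  by exists U.
by apply: Uy; rewrite -xy.
Qed.

Lemma semi_open_setC1_Tomega :
  (forall y : X, semi_open (~` [set y])) -> semi_Tomega X.
Proof.
move=> oC1 A [F [cF AF minF]].
suff -> : A = F by [].
apply/seteqP; split=> // y Fy; apply: contrapT => Ay.
by apply: (minF _ (oC1 y) _ y Fy) => // z Az zy; apply: Ay; rewrite -zy.
Qed.

Lemma semi_Tomega_T5omega_8 : semi_Tomega X -> semi_T5omega_8 X.
Proof.
move=> Tw P y Py; exists (~` [set y]); split=> [z Pz zy||].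
- by apply: Py; rewrite -zy.
- by apply.
have [|noC1] := pselect (semi_open (~` [set y])); first by left.
right; apply: Tw; exists setT; split=> [||O oO yO z _] //.
  exact: semi_closedT.
apply: contrapT => Oz; apply: noC1.
suff <- : O = ~` [set y] by [].
have zy : z = y by apply: contrapT => /yO.
by apply/seteqP; split=> // t Ot ty; apply: Oz; rewrite zy -ty.
Qed.

Lemma semi_Tomega_4_T0 : semi_Tomega_4 X -> semi_T0 X.
Proof.
move=> T4 x y xy.
have [|A [xA Ay oA]] := T4 _ (finite_set1 x) y; first by move=> /esym.
have Ax : A x by exact: xA.
case: oA => oA; first by exists A; split=> //; left.
by exists (~` A); split=> //; right; split=> //; apply.
Qed.

End SigmaSpaceTheory.

Theorem theorem5p35 (X : sigmaSpace)
  (symX : semi_symmetric X)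
  (capX : forall G : set (set X),
     G `<=` @is_closed X -> semi_closed (\bigcap_(F in G) F)) :
  [<-> semi_T0 X;
       semi_T1 X;
       semi_Tomega X;
       semi_T5omega_8 X;
       semi_T3omega_8 X;
       semi_Tomega_4 X].
Proof.
tfae.
- exact: semi_T0_T1.
- move=> T1; apply: semi_open_setC1_Tomega.
  by apply: semi_T1_semi_open_setC1 => //; exact: semi_open_bigcup.
- exact: semi_Tomega_T5omega_8.
- by move=> T5 P _; exact: T5.
- by move=> T3 P finP; apply: T3; exact: finite_set_countable.
- exact: semi_Tomega_4_T0.
Qed.
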